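(* Let $G$ be a choked graph, and let the couplings on the edges of $G$ be i.i.d. with a symmetric continuous distribution whose support is all of $\mathbb{R}$. Then with probability $1$ $G$ has only one ground state pair (GSP).
   Context: A locally finite planar graph is a planar graph (embedded in the plane) such that every compact subset of the plane contains at most finitely many of its vertices. A cycle $\mathcal{C}$ (simple closed path) in the graph surrounds an object if the object lies in the bounded component of the plane after deleting $\mathcal{C}$. For an integer $N$ and a vertex $v$, a cycle $\mathcal{C}$ is said to $N$-choke $v$ if $\mathcal{C}$ surrounds $v$ and the number of edges that lie on $\mathcal{C}$ or touch a vertex of $\mathcal{C}$ is smaller than $N$. A locally finite planar graph is choked if for every vertex $v$ there is a positive integer $N=N(v)$ and a sequence of cycles $\{\mathcal{C}_n\}_{n\in\mathbb{N}}$ in the graph such that each $\mathcal{C}_n$ $N$-chokes $v$ and, for all $n\in\mathbb{N}$, $\mathcal{C}_{n+1}$ surrounds $\mathcal{C}_n$. Given couplings $\mathcal{J}=(J_{xy})$ on the edges of $G$, a configuration $\sigma\in\{-1,1\}^{V(G)}$ is a ground state if for every finite set $C$ of vertices $-\sum_{\langle x,y\rangle\in\partial C}J_{xy}\sigma_x\sigma_y\le 0$, where $\partial C$ is the set of edges connecting $C$ to its complement. If $\sigma$ is a ground state so is $-\sigma$; the pair $\{\sigma,-\sigma\}$ is a ground state pair (GSP).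
   Formalization: The graph G is additionally assumed to be connected; without this the claim fails, since flipping all spins of one component of a disconnected choked graph gives a second ground state pair. *)

(* Defs.v *)
From HB Require Import structures.
From mathcomp Require Import all_boot all_order all_algebra finmap.
From mathcomp Require Import all_classical all_reals all_analysis.

Set Implicit Arguments.
Unset Strict Implicit.
Unset Printing Implicit Defensive.

Import Order.TTheory GRing.Theory Num.Theory.
Import numFieldNormedType.Exports.

Local Open Scope fset_scope.
Local Open Scope classical_set_scope.
Local Open Scope ring_scope.

Definition is_arc (R : realType) (A : set (R * R)) (p q : R * R) :=
  exists gamma : R -> R * R,
    [/\ {within `[0, 1], continuous gamma},
        {in `[0, 1]%classic &, injective gamma},
        gamma 0 = p, gamma 1 = q & A = gamma @` `[0, 1]].

(* A simple graph on V together with an embedding in the plane R * R; an edge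
   is the two-element set of its endpoints.  [arc e] is only meaningful when
   [e] is an edge. *)
Record plane_graph (R : realType) (V : choiceType) := PlaneGraph {
  edges : set {fset V};
  pos : V -> R * R;
  arc : {fset V} -> set (R * R);
  edges_card2 : forall e, edges e -> #|` e| = 2%N;
  pos_inj : injective pos;
  arcP : forall x y, edges [fset x; y] ->
    is_arc (arc [fset x; y]) (pos x) (pos y);
  arc_vertex : forall e x, edges e -> arc e (pos x) -> x \in e;
  arc_meet : forall e e', edges e -> edges e' -> e <> e' ->
    arc e `&` arc e' `<=` [set pos x | x in [set x | x \in e /\ x \in e']] }.

Section Graph.
Variables (R : realType) (V : choiceType) (G : plane_graph R V).

Definition adj : rel V := fun x y => `[< edges G [fset x; y] >].

Definition connected_graph :=
  forall x y : V, exists2 p : seq V, path adj x p & y = last x p.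

Definition locally_finite :=
  forall K : set (R * R), compact K -> finite_set (pos G @^-1` K).

(* A simple closed path, listed by its vertices. *)
Definition is_cycle (c : seq V) := ucycle adj c /\ (2 < size c)%N.

Definition cycle_edges (c : seq V) : set {fset V} :=
  [set [fset x; next c x] | x in [set` c]].

Definition cycle_curve (c : seq V) : set (R * R) :=
  \bigcup_(e in cycle_edges c) arc G e.

(* By the Jordan curve theorem, the complement of [cycle_curve c] has exactly
   one bounded component when [c] is a cycle. *)
Definition surrounds (c : seq V) (A : set (R * R)) :=
  exists p : R * R,
    [/\ (~` cycle_curve c) p,
        bounded_set (connected_component (~` cycle_curve c) p) &
        A `<=` connected_component (~` cycle_curve c) p].

Definition touched_edges (c : seq V) : set {fset V} :=
  [set e | edges G e /\ (cycle_edges c e \/ exists2 x, x \in c & x \in e)].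

Definition chokes (N : nat) (v : V) (c : seq V) :=
  [/\ is_cycle c, surrounds c [set pos G v],
      finite_set (touched_edges c) &
      (#|` fset_set (touched_edges c)| < N)%N].

Definition choked :=
  locally_finite /\
  forall v : V, exists N : nat, (0 < N)%N /\
  exists C : nat -> seq V,
    (forall n, chokes N v (C n)) /\
    (forall n, surrounds (C n.+1) (cycle_curve (C n))).

Definition edge_boundary (C : {fset V}) : set {fset V} :=
  [set e | edges G e /\ exists x y, [/\ e = [fset x; y], x \in C & y \notin C]].

Definition spin_config (s : V -> R) := forall x, s x = 1 \/ s x = -1.

(* The product over the two endpoints of [e = {x, y}] is s x * s y.  The
   boundary is finite whenever the degrees are, as in a choked graph; a finitely
   supported sum over an infinite set would be 0 by convention otherwise. *)
Definition ground_state (J : {fset V} -> R) (s : V -> R) :=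
  spin_config s /\
  forall C : {fset V},
    - (\sum_(e \in edge_boundary C) J e * \prod_(x <- e) s x) <= 0.

Definition ground_state_pair (J : {fset V} -> R) (S : set (V -> R)) :=
  exists2 s, ground_state J s & S = [set s; (fun x => - s x)].

End Graph.

Section Couplings.
Variable R : realType.

Definition symmetric_law (mu : probability R R) :=
  forall A : set R, measurable A -> mu ((fun x => - x) @^-1` A) = mu A.

Definition continuous_law (mu : probability R R) :=
  continuous (fun r : R => mu `]-oo, r]%classic).

Definition law_support (mu : probability R R) : set R :=
  [set x | forall U : set R, open U -> U x -> (0 < mu U)%E].

Definition independent_on d (T : measurableType d) (P : probability T R)
    (I : choiceType) (E : set I) (X : I -> {RV P >-> R}) :=
  forall (F : {fset I}) (A : I -> set R),
    [set` F] `<=` E -> (forall i, measurable (A i)) ->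
    P (\bigcap_(i in [set` F]) (X i @^-1` A i)) =
    (\prod_(i <- F) P (X i @^-1` A i))%E.

Definition iid_on d (T : measurableType d) (P : probability T R)
    (I : choiceType) (E : set I) (X : I -> {RV P >-> R})
    (mu : probability R R) :=
  independent_on E X /\
  forall i, E i -> forall A : set R, measurable A ->
    distribution P (X i) A = mu A.

End Couplings.

(* Main.v *)
(* If the couplings on one of the cycles C_n around v exceed 1 while those on
   the other edges touching C_n are below 1/N in absolute value, then every
   ground state is constant on C_n, as flipping part of C_n would otherwise
   lower the energy.  This happens with a probability bounded below in n, and
   independently for cycles at distance at least two in the sequence, hence for
   infinitely many n.  Two ground states that agree on C_n up to a global sign
   agree inside C_n: the set where they differ has boundary energy zero, which
   a nontrivial signed sum of couplings almost surely is not.  Since G is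
   connected, the interiors of the C_n exhaust it.

   The Jordan curve theorem is avoided: nesting of the interiors follows from
   the fact that the plane has no nonempty bounded clopen subset.  Existence is
   obtained from finite-volume ground states by a limit along an ultrafilter. *)
From HB Require Import structures.
Require Import Defs.
From mathcomp Require Import all_boot all_order all_algebra finmap.
From mathcomp Require Import all_classical all_reals all_analysis.
From mathcomp Require Import measurable_realfun ring lra.

Set Implicit Arguments.
Unset Strict Implicit.
Unset Printing Implicit Defensive.

Import Order.TTheory GRing.Theory Num.Theory.
Import numFieldNormedType.Exports.

Local Open Scope classical_set_scope.
Local Open Scope ring_scope.

(** * Components of plane open sets *)

Section Plane.
Variable R : realType.
Implicit Types (p q : R * R) (A O K W : set (R * R)).

Definition segment p q (t : R) : R * R :=
  (p.1 + t * (q.1 - p.1), p.2 + t * (q.2 - p.2)).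

Lemma segment_continuous p q : continuous (segment p q).
Proof.
move=> t; apply: (@cvg_pair _ _ _ _ (nbhs (p.1 + t * (q.1 - p.1)))
  (nbhs (p.2 + t * (q.2 - p.2)))); apply: cvgD; try exact: cvg_cst;
  by apply: cvgM; [exact: cvg_id|exact: cvg_cst].
Qed.

Lemma segment0 p q : segment p q 0 = p.
Proof. by case: p q => a b [c e]; rewrite /segment /= !mul0r !addr0. Qed.

Lemma segment1 p q : segment p q 1 = q.
Proof. by case: p q => a b [c e]; rewrite /segment /= !mul1r !subrKC. Qed.

Lemma segment_ball p q e t : 0 <= t -> t <= 1 -> ball p e q ->
  ball p e (segment p q t).
Proof.
move=> t0 t1 [].
have H (a b : R) : ball a e b -> ball a e (a + t * (b - a)).
  rewrite /ball /= -(opprB b a) normrN opprD addNKr normrN normrM (ger0_norm t0).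
  by apply: le_lt_trans; rewrite ler_piMl.
by move=> /H h1 /H h2; split.
Qed.

(** Segments join each point of a ball to its centre, so a ball inside [O] stays within one
    component. *)
Lemma open_connected_component O p : open O -> open (connected_component O p).
Proof.
move=> oO; rewrite openE => z Cz.
have Oz : O z by exact: connected_component_sub Cz.
have /nbhs_ballP[e /= e0 eO] : nbhs z O by exact: open_nbhs_nbhs.
apply/nbhs_ballP; exists e => //= q zq.
apply: (connected_component_trans Cz).
have zqO : segment z q @` `[0, 1] `<=` O.
  by move=> y [t /=]; rewrite in_itv /= => /andP[t0 t1] <-; apply/eO/segment_ball.
apply: (connected_component_max _ zqO).
- by exists 0; rewrite ?segment0 //= in_itv /= lexx ler01.
- apply: connected_continuous_connected; first exact: segment_connected.
  exact/continuous_subspaceT/segment_continuous.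
- by exists 1; rewrite ?segment1 //= in_itv /= lexx ler01.
Qed.

(** The component of a limit point in [O] is an open neighbourhood of it, so it meets the component
    of [p]. *)
Lemma closure_connected_component O p : open O ->
  closure (connected_component O p) `&` O `<=` connected_component O p.
Proof.
move=> oO z [clz Oz].
have /clz[y [py zy]] : nbhs z (connected_component O z).
  apply: open_nbhs_nbhs; split; first exact: open_connected_component.
  exact: connected_component_refl.
exact/(connected_component_trans py)/connected_component_sym.
Qed.

Lemma bounded_set_box A : bounded_set A ->
  exists2 M : R, 0 <= M & A `<=` `[- M, M] `*` `[- M, M].
Proof.
move=> [M [_ HM]]; exists (`|M| + 1) => [|p Ap]; first by rewrite addr_ge0.
have := HM (`|M| + 1) (ltr_pwDr ltr01 (ler_norm M)) p Ap.
rewrite /= prod_normE ge_max => /andP[p1 p2].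
by split; rewrite /= in_itv /= -ler_norml.
Qed.

Lemma bounded_setU A W : bounded_set A -> bounded_set W -> bounded_set (A `|` W).
Proof.
move=> [M [Mr HM]] [N [Nr HN]]; exists (Num.max M N).
split=> [|y]; first exact: num_real.
by rewrite gt_max => /andP[/HM Ay /HN Wy] x [/Ay|/Wy].
Qed.

(** Pulled back along a line through a point of [A], a clopen set is clopen in the reals, hence
    everything; a nonempty [A] would be the whole plane. *)
Lemma bounded_clopen_eq0 A : bounded_set A -> open A -> closed A -> A = set0.
Proof.
move=> bA oA cA; apply/eqP/negPn/negP => /set0P[p Ap].
have AT q : A q.
  suff : segment p q @^-1` A = setT.
    by move=> /seteqP[_ /(_ 1 I)]; rewrite /= segment1.
  have /connected_intervalP cT : is_interval [set: R] by [].
  apply: cT.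
  - by exists 0; rewrite /= segment0.
  - exists (segment p q @^-1` A); rewrite ?setTI //.
    by apply: open_comp => // t _; exact: segment_continuous.
  - exists (segment p q @^-1` A); rewrite ?setTI //.
    by apply: closed_comp => // t _; exact: segment_continuous.
have [M M0 /(_ (M + 1, 0) (AT _))[/= + _]] := bounded_set_box bA.
by rewrite in_itv /=; lra.
Qed.

(* If [K2] met [W], connectedness would put it inside [W], and [U `|` W] would
   be a bounded clopen set. *)
Lemma nested_components K1 K2 u v (U := connected_component (~` K2) u)
    (W := connected_component (~` K1) v) :
  closed K1 -> closed K2 -> (W `&` K2 !=set0 -> K2 `<=` W) ->
  bounded_set U -> bounded_set W -> ~ K1 v -> K1 `<=` U -> W `<=` U.
Proof.
move=> cK1 cK2 K2W bU bW K1v K1U.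
have oU : open U by apply: open_connected_component; exact: closed_openC.
have oW : open W by apply: open_connected_component; exact: closed_openC.
have Wv : W v by exact: connected_component_refl.
have clU z : closure U z -> U z \/ K2 z.
  move=> Uz; have [|K2z] := pselect (K2 z); [by right|left].
  by apply: closure_connected_component => //; exact: closed_openC.
have clW z : closure W z -> W z \/ K1 z.
  move=> Wz; have [|K1z] := pselect (K1 z); [by right|left].
  by apply: closure_connected_component => //; exact: closed_openC.
have W2 : W `<=` ~` K2.
  move=> z Wz K2z; have {}K2W : K2 `<=` W by apply: K2W; exists z.
  have : U `|` W = set0.
    apply: bounded_clopen_eq0; first exact: bounded_setU.
      exact: openU.
    move=> y; rewrite closureU => -[/clU[]|/clW[]]; [by left| |by right|].
      by move/K2W; right.
    by move/K1U; left.
  by move=> /seteqP[/(_ v)] H _; apply: H; right.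
(* [W] is open, bounded and nonempty, hence not closed: its closure must reach [K1], which lies in
   the open set [U]. *)
have [z [Wz K1z]] : closure W `&` K1 !=set0.
  apply: contrapT => H.
  have W0 : W = set0.
    apply: bounded_clopen_eq0 => // y Wy; have [//|K1y] := clW _ Wy.
    by case: H; exists y.
  by move: Wv; rewrite W0.
have /Wz[y [Wy Uy]] : nbhs z U by apply: open_nbhs_nbhs; split=> //; exact: K1U.
move=> x Wx; apply: (connected_component_trans Uy).
by apply: (connected_component_max Wy W2 _ Wx); exact: component_connected.
Qed.

End Plane.

(** * Nested cycles *)

(* [arc] would otherwise be the sub-arc of a sequence from [path]. *)
Local Notation arc := Defs.arc.

Section PlaneGraph.
Variables (R : realType) (V : choiceType) (G : plane_graph R V).
Implicit Types (x y : V) (c : seq V) (e : {fset V}).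

Lemma adjP x y : reflect (edges G [fset x; y]%fset) (adj G x y).
Proof. exact: asboolP. Qed.

Lemma edge_neq x y : edges G [fset x; y]%fset -> x != y.
Proof. by move=> /edges_card2; rewrite cardfs2; case: eqP. Qed.

Lemma edgeE e x y : edges G e -> x \in e -> y \in e -> x != y ->
  e = [fset x; y]%fset.
Proof.
move=> /edges_card2 e2 xe ye xy; apply/esym/eqP.
by rewrite eqEfcard e2 cardfs2 xy andbT fsubUset !fsub1set xe ye.
Qed.

Lemma edge_other e x : edges G e -> x \in e ->
  exists2 y, x != y & e = [fset x; y]%fset.
Proof.
move=> Ge xe; have : (0 < #|` (e `\ x)%fset|)%N.
  by have := edges_card2 Ge; rewrite (cardfsD1 x) xe; case: #|`_|.
rewrite cardfs_gt0 => /fset0Pn[y]; rewrite !inE => /andP[yx ye].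
by exists y; [rewrite eq_sym|apply: edgeE; rewrite // eq_sym].
Qed.

Section Arc.
Variables (x y : V).
Hypothesis Gxy : edges G [fset x; y]%fset.

Lemma arc_compact : compact (arc G [fset x; y]%fset).
Proof.
by have [g [gc _ _ _ ->]] := arcP Gxy; apply: continuous_compact => //;
  exact: segment_compact.
Qed.

Lemma arc_connected : connected (arc G [fset x; y]%fset).
Proof.
by have [g [gc _ _ _ ->]] := arcP Gxy; apply: connected_continuous_connected => //;
  exact: segment_connected.
Qed.

Lemma arc_left : arc G [fset x; y]%fset (pos G x).
Proof.
have [g [_ _ g0 _ ->]] := arcP Gxy; exists 0 => //.
by rewrite /= in_itv /= lexx ler01.
Qed.

Lemma arc_right : arc G [fset x; y]%fset (pos G y).
Proof.
have [g [_ _ _ g1 ->]] := arcP Gxy; exists 1 => //.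
by rewrite /= in_itv /= lexx ler01.
Qed.

Lemma arc_in_component (O : set (R * R)) p q :
  arc G [fset x; y]%fset `<=` O -> arc G [fset x; y]%fset q ->
  connected_component O p q ->
  arc G [fset x; y]%fset `<=` connected_component O p.
Proof.
move=> sO aq pq z az; apply: (connected_component_trans pq).
by apply: (connected_component_max aq sO _ az); exact: arc_connected.
Qed.

End Arc.

(** * Cycles of the graph as curves in the plane *)

Lemma cycle_edge c x : is_cycle G c -> x \in c ->
  edges G [fset x; next c x]%fset.
Proof. by move=> [/andP[cc _] _] xc; apply/adjP/next_cycle. Qed.

(** Rotating [c] to start at [x0] makes it a path of successors along which [Q] propagates. *)
Lemma cycle_ind c (Q : V -> Prop) x0 : uniq c -> x0 \in c -> Q x0 ->
  (forall x, x \in c -> Q x -> Q (next c x)) -> forall x, x \in c -> Q x.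
Proof.
move=> uc x0c Qx0 Qn; have [i p cE] := rot_to x0c.
have pc : path (fun a b => b == next c a) x0 p.
  have : cycle (fun a b => b == next c a) (rot i c).
    rewrite rot_cycle; have := cycle_next uc.
    by apply: sub_cycle => a b /=; rewrite eq_sym.
  by rewrite cE /= rcons_path => /andP[].
have sub : {subset p <= c}.
  by move=> x xp; rewrite -(mem_rot i) cE inE xp orbT.
move=> x; rewrite -(mem_rot i) cE inE => /predU1P[-> //|].
elim: p x0 pc x0c Qx0 sub {cE} => //= y p IH x0 /andP[/eqP yE pc] x0c Qx0 sub.
have Qy : Q y by rewrite yE; exact: Qn.
have yc : y \in c by apply: sub; rewrite mem_head.
rewrite inE => /predU1P[-> //|]; apply: (IH y) => // z zp.
by apply: sub; rewrite inE zp orbT.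
Qed.

Lemma cycle_curveE c : cycle_curve G c =
  \bigcup_(x in [set` c]) arc G [fset x; next c x]%fset.
Proof. by rewrite /cycle_curve /cycle_edges bigcup_image. Qed.

Lemma cycle_curve_closed c : is_cycle G c -> closed (cycle_curve G c).
Proof.
move=> cc; rewrite cycle_curveE; apply: closed_bigcup => [|x /= xc].
  exact: finite_seq.
apply: compact_closed; last exact/arc_compact/cycle_edge.
exact: norm_hausdorff.
Qed.

Lemma pos_cycle_curve c x : is_cycle G c -> cycle_curve G c (pos G x) <-> x \in c.
Proof.
move=> cc; rewrite cycle_curveE; split => [[y /= yc]|xc].
  move=> /(arc_vertex (cycle_edge cc yc)); rewrite !inE => /orP[]/eqP-> //.
  by rewrite mem_next.
by exists x => //; exact/arc_left/cycle_edge.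
Qed.

Lemma cycle_edges_sub c e x : cycle_edges c e -> x \in e -> x \in c.
Proof.
by move=> [y /= yc <-]; rewrite !inE => /orP[]/eqP-> //; rewrite mem_next.
Qed.

(** Distinct edges meet only at common endpoints, and neither end of this edge is on [c], so its
    whole arc avoids the curve. *)
Lemma adj_component c p x y : is_cycle G c -> adj G x y -> y \notin c ->
  connected_component (~` cycle_curve G c) p (pos G x) ->
  connected_component (~` cycle_curve G c) p (pos G y).
Proof.
move=> cc /adjP Gxy yc Wx.
have xc : x \notin c.
  apply/negP => /(pos_cycle_curve x cc); exact: (connected_component_sub Wx).
apply: (arc_in_component Gxy _ (arc_left Gxy) Wx); last exact: arc_right.
move=> q aq [e' ce' ae'].
have Ge' : edges G e' by move: ce' => [z /= zc <-]; exact: cycle_edge.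
have ee' : [fset x; y]%fset <> e'.
  move=> ee'; move: xc; rewrite (cycle_edges_sub ce') //.
  by rewrite -ee' !inE eqxx.
have [z [ze /(cycle_edges_sub ce') zc] _] := arc_meet Gxy Ge' ee' (conj aq ae').
move: ze; rewrite !inE => /orP[]/eqP zE; first by move: xc; rewrite -zE zc.
by move: yc; rewrite -zE zc.
Qed.

(** The premise of [nested_components] on the outer curve follows by walking along [c2], whose arcs
    are connected and avoid the curve of [c1]. *)
Lemma nested_cycles c1 c2 p1 p2 (U := connected_component (~` cycle_curve G c2) p2)
    (W := connected_component (~` cycle_curve G c1) p1) :
  is_cycle G c1 -> is_cycle G c2 -> bounded_set U -> bounded_set W ->
  ~ cycle_curve G c1 p1 -> cycle_curve G c1 `<=` U -> W `<=` U.
Proof.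
move=> cc1 cc2 bU bW p1P K1U.
apply: nested_components => //; try exact: cycle_curve_closed.
have avoid : cycle_curve G c2 `<=` ~` cycle_curve G c1.
  by move=> q K2q /K1U /connected_component_sub.
move=> [q [Wq]]; rewrite {1 2}cycle_curveE => -[x /= xc ax].
have sub y : y \in c2 -> arc G [fset y; next c2 y]%fset `<=` ~` cycle_curve G c1.
  by move=> yc z az; apply: avoid; rewrite cycle_curveE; exists y.
have Wx := arc_in_component (cycle_edge cc2 xc) (sub _ xc) ax Wq.
have Wpos y : y \in c2 -> W (pos G y).
  move: y; apply: (@cycle_ind _ (fun y => W (pos G y)) x) => //.
  - by case: cc2 => /andP[].
  - exact/Wx/arc_left/cycle_edge.
  - move=> y yc Wy; have Gy := cycle_edge cc2 yc.
    exact: (arc_in_component Gy (sub _ yc) (arc_left Gy) Wy (arc_right Gy)).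
move=> z [y /= yc az]; have Gy := cycle_edge cc2 yc.
exact: (arc_in_component Gy (sub _ yc) (arc_left Gy) (Wpos _ yc) az).
Qed.

Lemma locally_finite_bounded (A : set (R * R)) : locally_finite G ->
  bounded_set A -> finite_set (pos G @^-1` A).
Proof.
move=> lf /bounded_set_box[M _ AM].
apply: (@sub_finite_set _ _ (pos G @^-1` (`[- M, M] `*` `[- M, M]))).
  by move=> x /AM.
by apply: lf; apply: compact_setX; exact: segment_compact.
Qed.

(** Naming the component by a fixed vertex, instead of the unnamed point in [surrounds], makes the
    interiors of different cycles comparable. *)
Definition interior_at c v := connected_component (~` cycle_curve G c) (pos G v).

Lemma surrounds_interior c v : surrounds G c [set pos G v] ->
  bounded_set (interior_at c v) /\ interior_at c v (pos G v).
Proof.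
move=> [p [pK bp /(_ _ erefl) pv]].
rewrite /interior_at -(same_connected_component pv); split => //.
Qed.

Lemma interior_finite c v : locally_finite G -> surrounds G c [set pos G v] ->
  finite_set [set x | interior_at c v (pos G x)].
Proof. by move=> lf /surrounds_interior[bW _]; exact: locally_finite_bounded. Qed.

(** * Nested sequences of choking cycles *)

Section Nest.
Variables (v : V) (N : nat) (C : nat -> seq V).
Hypothesis chokeC : forall n, chokes G N v (C n).
Hypothesis nestC : forall n, surrounds G (C n.+1) (cycle_curve G (C n)).
Local Notation K n := (cycle_curve G (C n)).
Local Notation W n := (interior_at (C n) v).

Let cycC n : is_cycle G (C n). Proof. by case: (chokeC n). Qed.

Lemma interior_disjoint n x : W n (pos G x) -> x \notin C n.
Proof.
move=> Wx; apply/negP => /(pos_cycle_curve x (cycC n)).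
exact: connected_component_sub Wx.
Qed.

(** The component that witnesses the nesting contains the interior of [C n], hence the position of
    [v], so it is the interior of [C n.+1]. *)
Let nestS n : W n `<=` W n.+1 /\ K n `<=` W n.+1.
Proof.
have [_ /surrounds_interior[bW Wv] _ _] := chokeC n.
have [p [pK bU KU]] := nestC n.
have vK : ~ K n (pos G v) by exact: connected_component_sub Wv.
have WU := nested_cycles (cycC n) (cycC n.+1) bU bW vK KU.
have UE : connected_component (~` cycle_curve G (C n.+1)) p = W n.+1.
  by apply: same_connected_component; exact: WU.
by rewrite UE in WU KU.
Qed.

Lemma interior_le m n : (m <= n)%N -> W m `<=` W n.
Proof.
elim: n => [|n IH]; first by rewrite leqn0 => /eqP->.
rewrite leq_eqVlt => /predU1P[-> //|/IH mn]; apply: subset_trans mn _.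
by case: (nestS n).
Qed.

Lemma curve_interior m n : (m < n)%N -> K m `<=` W n.
Proof. by move=> /interior_le; apply: subset_trans; case: (nestS m). Qed.

Lemma mem_cycle_interior m n x : (m < n)%N -> x \in C m -> W n (pos G x).
Proof. by move=> mn xm; apply: (curve_interior mn); exact/pos_cycle_curve. Qed.

(** Along a path from [v], each step either stays inside the current cycle or lands on it, and then
    it is inside the next one. *)
Lemma interior_exhausts x : connected_graph G -> exists n, W n (pos G x).
Proof.
move=> cG; have [p vp ->] := cG v x.
have : exists n, W n (pos G v).
  exists 0%N; have [_ sv _ _] := chokeC 0%N.
  by have [] := surrounds_interior sv.
suff step x0 : path (adj G) x0 p -> (exists n, W n (pos G x0)) ->
    exists n, W n (pos G (last x0 p)) by exact: step.
elim: p x0 {vp} => //= y p IH x0 /andP[x0y yp] [n Wn].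
apply: IH => //; have [yn|yn] := boolP (y \in C n).
  by exists n.+1; exact: (@mem_cycle_interior n).
by exists n; exact: adj_component x0y yn Wn.
Qed.

Lemma touched_edgesP c e : is_cycle G c -> touched_edges G c e ->
  edges G e /\ exists2 x, x \in c & x \in e.
Proof.
move=> cc [Ge [[x /= xc eE]|//]]; split=> //; exists x => //.
by rewrite -eE !inE eqxx.
Qed.

(** A common edge would run from a vertex of [C m], inside [C m.+1], to a vertex of [C n], which is
    neither inside nor on [C m.+1]. The gap of two provides this separating cycle. *)
Lemma touched_edges_disjoint m n e : (m.+1 < n)%N ->
  touched_edges G (C m) e -> ~ touched_edges G (C n) e.
Proof.
move=> mn /(touched_edgesP (cycC m))[Ge [x xm xe]].
move=> /(touched_edgesP (cycC n))[_ [y yn ye]].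
have notW i : (i <= n)%N -> ~ W i (pos G y).
  by move=> /interior_le WW /WW/interior_disjoint; rewrite yn.
have xy : x != y.
  apply/eqP => xy; apply: (notW m.+1); first exact: ltnW.
  by rewrite -xy; exact: (@mem_cycle_interior m).
have axy : adj G x y by apply/adjP; rewrite -(edgeE Ge xe ye xy).
apply: (notW m.+1); first exact: ltnW.
apply: (adj_component (cycC _) axy); last exact: (@mem_cycle_interior m).
by apply/negP => /(mem_cycle_interior mn); exact: notW.
Qed.

End Nest.

(** Every neighbour of [x] lies on or inside one cycle that chokes [x], and only finitely many
    vertices lie inside. *)
Lemma finite_degree x : choked G -> finite_set [set e | edges G e /\ x \in e].
Proof.
move=> [lf /(_ x)[N [_ [C [chC _]]]]].
have [cc sx _ _] := chC 0%N.
pose A := [set y | interior_at (C 0%N) x (pos G y)] `|` [set` C 0%N].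
apply: (@sub_finite_set _ _ ((fun y => [fset x; y]%fset) @` A)).
  move=> e [Ge xe]; have [y xy eE] := edge_other Ge xe; exists y => //.
  have [yc|yc] := boolP (y \in C 0%N); [by right|left => /=].
  have axy : adj G x y by apply/adjP; rewrite -eE.
  exact: (adj_component cc axy yc (surrounds_interior sx).2).
apply/finite_image; rewrite finite_setU; split; last exact: finite_seq.
exact: interior_finite.
Qed.

Lemma finite_edge_boundary (D : {fset V}) : choked G ->
  finite_set (edge_boundary G D).
Proof.
move=> chG; apply: (@sub_finite_set _ _
  (\bigcup_(x in [set` D]) [set e | edges G e /\ x \in e])).
  move=> e [Ge [x [y [eE xD yD]]]]; exists x => //=; split=> //.
  by rewrite eE !inE eqxx.
by apply: bigcup_finite => // x _; exact: finite_degree.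
Qed.

End PlaneGraph.

(** * Ground states for fixed couplings *)

Section GroundStates.
Variables (R : realType) (V : choiceType) (G : plane_graph R V).
Implicit Types (x y : V) (c : seq V) (e : {fset V}) (s : V -> R).

Definition bond s e : R := \prod_(x <- e) s x.

Lemma bond2 s x y : x != y -> bond s [fset x; y]%fset = s x * s y.
Proof. by move=> xy; rewrite /bond big_fsetU1 ?inE //= big_seq_fset1. Qed.

Lemma spin_sqr s x : spin_config s -> s x * s x = 1.
Proof. by move=> /(_ x)[]->; rewrite ?mulrNN mulr1. Qed.

Lemma spin_mul_neq s x y : spin_config s -> s x != s y -> s x * s y = -1.
Proof.
by move=> sc; case: (sc x) => ->; case: (sc y) => ->;
  rewrite ?eqxx // => _; rewrite ?mulr1 ?mul1r.
Qed.

Lemma spin_norm s x : spin_config s -> `|s x| = 1.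
Proof. by case/(_ x) => ->; rewrite ?normrN normr1. Qed.

Lemma bond_norm s e : spin_config s -> `|bond s e| = 1.
Proof.
by move=> sc; rewrite /bond normr_prod big1_seq // => x _; exact: spin_norm.
Qed.

Lemma bond_sign s e : spin_config s -> bond s e = 1 \/ bond s e = -1.
Proof.
move=> /(bond_norm e)/eqP; rewrite eqr_norml ler01 andbT.
by move=> /orP[]/eqP; [left|right].
Qed.

(** Finite degrees exclude the default value 0 of a sum with infinite support. *)
Lemma boundary_sumE (J : {fset V} -> R) s (D : {fset V}) : choked G ->
  \sum_(e \in edge_boundary G D) J e * \prod_(x <- e) s x =
  \sum_(e <- fset_set (edge_boundary G D)) J e * bond s e.
Proof. by move=> chG; rewrite fsbig_finite //; exact: finite_edge_boundary. Qed.

Lemma ground_stateP (J : {fset V} -> R) s : choked G -> ground_state G J s <->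
  spin_config s /\ forall D : {fset V},
    0 <= \sum_(e <- fset_set (edge_boundary G D)) J e * bond s e.
Proof.
by move=> chG; split=> -[sc gs]; split=> // D; have := gs D;
  rewrite boundary_sumE // oppr_le0.
Qed.

Lemma edge_boundary_nonempty (D : {fset V}) x y : connected_graph G ->
  x \in D -> y \notin D -> edge_boundary G D !=set0.
Proof.
move=> cG xD yD; have [p + yE] := cG x y; rewrite {}yE in yD.
elim: p x xD yD => /= [x ->//|z p IH x xD lD /andP[/adjP Gxz zp]].
have [zD|zD] := boolP (z \in D); first exact: (IH z).
by exists [fset x; z]%fset; split=> //; exists x, z.
Qed.

(** * Rigidity on good cycles and uniqueness of the pair *)

Definition good_cycle (J : {fset V} -> R) (N : nat) c :=
  (forall e, cycle_edges c e -> 1 < J e) /\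
  (forall e, touched_edges G c e -> ~ cycle_edges c e -> `|J e| < N%:R^-1).

(* Flipping the spins of the cycle that agree with [s x] would gain more than
   1 on the edge from [x] to [next c x] and lose less than [N * N^-1] on the
   other touched edges. *)
Lemma good_cycle_constant (J : {fset V} -> R) N v c s x0 x : choked G ->
  chokes G N v c -> good_cycle J N c -> ground_state G J s ->
  x0 \in c -> x \in c -> s x = s x0.
Proof.
move=> chG [cc _ fT cT] [Jc Jt] /(ground_stateP _ _ chG)[sc gs] x0c.
have [/andP[_ uc] _] := cc.
move: x; apply: (@cycle_ind _ c (fun x => s x = s x0) x0) => // x xc <-.
have nxc : next c x \in c by rewrite mem_next.
have Gx := cycle_edge cc xc.
apply/eqP/negPn/negP => nx.
pose A := [fset z | z in [seq z <- c | s z == s x]]%fset.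
have AE z : (z \in A) = (z \in c) && (s z == s x).
  by rewrite !inE mem_filter andbC.
pose e0 := [fset x; next c x]%fset.
have ce0 : cycle_edges c e0 by exists x.
have bA e : edge_boundary G A e -> touched_edges G c e.
  move=> [Ge [y [z [eE + _]]]]; rewrite AE => /andP[yc _].
  by split=> //; right; exists y => //; rewrite eE !inE eqxx.
have fA : finite_set (edge_boundary G A) by exact: finite_edge_boundary.
have e0A : e0 \in fset_set (edge_boundary G A).
  rewrite in_fset_set // inE; split=> //; exists x, (next c x).
  by split=> //; rewrite AE ?xc ?eqxx // nxc (negbTE nx).
have cA : (#|` fset_set (edge_boundary G A)| < N)%N.
  apply: leq_ltn_trans cT; apply: fsubset_leq_card.
  by apply/fsubsetP => e; rewrite !in_fset_set // !inE; exact: bA.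
have N0 : (0 < N%:R :> R) by rewrite ltr0n; exact: leq_ltn_trans cA.
have := gs A; rewrite (big_fsetD1 e0) //=; apply/negP; rewrite -ltNge.
have -> : J e0 * bond s e0 = - J e0.
  rewrite bond2 ?(edge_neq Gx) // spin_mul_neq ?mulrN1 //.
  by rewrite eq_sym.
rewrite addrC subr_lt0; apply: le_lt_trans (Jc _ ce0).
(* Each remaining term is at most 1/N: a cycle edge leaving [A] joins opposite spins and contributes
   negatively, and the other couplings are small. *)
apply: (@le_trans _ _ (\sum_(e <- (fset_set (edge_boundary G A) `\ e0)%fset) N%:R^-1)).
  rewrite big_seq [leRHS]big_seq; apply: ler_sum => e.
  rewrite !inE => /andP[_]; rewrite in_fset_set // inE => eA.
  have [ce|nce] := pselect (cycle_edges c e).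
    case: (eA) => Ge [y [z [eE yA zA]]].
    have zc : z \in c by apply: (cycle_edges_sub ce); rewrite eE !inE eqxx orbT.
    rewrite eE bond2; last by apply: (@edge_neq _ _ G); rewrite -eE.
    move: yA zA; rewrite !AE zc => /andP[_ /eqP ->] /= zx.
    rewrite spin_mul_neq // 1?eq_sym // mulrN1.
    apply: (@le_trans _ _ 0); last by rewrite invr_ge0 ltW.
    by rewrite oppr_le0 -eE; exact/ltW/(lt_trans ltr01)/Jc.
  apply: le_trans (ler_norm _) _; rewrite normrM bond_norm // mulr1.
  by apply: ltW; apply: Jt => //; exact: bA.
(* At most [N] terms remain, so the bound is at most 1. *)
rewrite big_const_seq count_predT iter_addr_0 -[_ *+ _]mulr_natl.
rewrite ler_pdivrMr // mul1r ler_nat; apply: leq_trans (ltnW cA).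
by apply: fsubset_leq_card; exact: fsubD1set.
Qed.

(** [S] collects the edges with sign plus; coding signs by a finite set leaves countably many
    conditions once the vertices are countable. *)
Definition nondegenerate (J : {fset V} -> R) := forall F S : {fset {fset V}},
  F != fset0 -> (forall e, e \in F -> edges G e) ->
  \sum_(e <- F) (if e \in S then J e else - J e) != 0.

(* Inside the cycle, the set where [s] and [t * s'] differ has the opposite
   boundary energies for [s] and [s'], hence zero energy. *)
Lemma ground_states_agree_inside (J : {fset V} -> R) N v c s s' :
  connected_graph G -> choked G -> nondegenerate J ->
  chokes G N v c -> good_cycle J N c ->
  ground_state G J s -> ground_state G J s' ->
  exists t : R, forall x, interior_at G c v (pos G x) -> s x = t * s' x.
Proof.
move=> cG chG nJ chc gc gs gs'.
have [cc sv fT cT] := chc; have [lf _] := chG.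
have [z0 z0c] : exists z0, z0 \in c.
  by have [_] := cc; case: (c) => // z0 c' _; exists z0; rewrite mem_head.
have [sc es] := (ground_stateP J s chG).1 gs.
have [sc' es'] := (ground_stateP J s' chG).1 gs'.
(* Both states are constant on the cycle, and [t] is their relative sign there. *)
pose t := s z0 * s' z0; exists t.
have tc z : z \in c -> s z = t * s' z.
  move=> zc; rewrite (good_cycle_constant chG chc gc gs z0c zc).
  by rewrite (good_cycle_constant chG chc gc gs' z0c zc) -mulrA spin_sqr ?mulr1.
have t2 : t * t = 1 by rewrite mulrACA !spin_sqr ?mulr1.
pose Dset := [set x | interior_at G c v (pos G x) /\ s x <> t * s' x].
have fD : finite_set Dset.
  by apply: sub_finite_set (interior_finite lf sv) => x [].
move=> x1 Wx1; apply: contrapT => sx1.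
pose D := fset_set Dset.
have DP x : (x \in D) = (x \in Dset) by rewrite in_fset_set.
have x1D : x1 \in D by rewrite DP inE.
have z0D : z0 \notin D.
  by apply/negP; rewrite DP inE => -[_]; rewrite -tc.
pose F := fset_set (edge_boundary G D).
have fF : finite_set (edge_boundary G D) by exact: finite_edge_boundary.
(* On a boundary edge the relative sign is [- t] at the end in [D] and [t] at the other end, which
   still lies inside or on [c]. *)
have opp e : e \in F -> bond s' e = - bond s e.
  rewrite in_fset_set // inE => -[Ge [x [y [eE xD yD]]]].
  have Gxy : edges G [fset x; y]%fset by rewrite -eE.
  move: xD; rewrite DP inE => -[Wx sx].
  have sy : s y = t * s' y.
    have [yc|yc] := boolP (y \in c); first exact: tc.
    apply: contrapT => sy; case/negP: yD; rewrite DP inE; split=> //.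
    exact: adj_component cc (introT (adjP _ _ _) Gxy) yc Wx.
  rewrite eE !bond2 ?(edge_neq Gxy) // sy.
  have -> : s x = - (t * s' x).
    move: sx; rewrite /t.
    by case: (sc x) (sc z0) (sc' z0) (sc' x) => -> [] -> [] -> [] ->;
      rewrite ?(mulr1, mulrN1, opprK).
  by rewrite mulNr opprK mulrACA t2 mul1r.
(* The boundary sum for [s] and its opposite, the sum for [s'], are both nonnegative. *)
have S0 : \sum_(e <- F) J e * bond s e = 0.
  apply/eqP; rewrite eq_le es andbT -oppr_ge0 -sumrN.
  suff -> : \sum_(e <- F) - (J e * bond s e) = \sum_(e <- F) J e * bond s' e.
    exact: es'.
  by apply: eq_big_seq => e eF; rewrite opp // mulrN.
have [e1 e1F] := edge_boundary_nonempty cG x1D z0D.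
have F0 : F != fset0 by apply/fset0Pn; exists e1; rewrite in_fset_set // inE.
have FG e : e \in F -> edges G e by rewrite in_fset_set // inE => -[].
have := nJ F [fset e in F | bond s e == 1]%fset F0 FG; apply/negP/negPn/eqP.
rewrite -[RHS]S0; apply: eq_big_seq => e eF; rewrite !inE eF /=.
case: (bond_sign e sc) => ->; rewrite ?eqxx ?mulr1 //.
by rewrite -subr_eq0 -opprD oppr_eq0 -mulr2n pnatr_eq0 /= mulrN1.
Qed.

Lemma ground_state_opp (J : {fset V} -> R) s s' :
  (forall x y, s x * s' x = s y * s' y) -> spin_config s -> spin_config s' ->
  [set s'; (fun x => - s' x)] = [set s; (fun x => - s x)].
Proof.
move=> ss sc sc'.
have [[v _]|V0] := pselect ([set: V] !=set0); last first.
  have eqV (f g : V -> R) : f = g by apply/funext => x; case: V0; exists x.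
  by rewrite (eqV s' s).
have : s' = s \/ s' = (fun x => - s x).
  have sE x : s' x = s v * s' v * s x by rewrite -(ss x) mulrAC spin_sqr ?mul1r.
  by case: (sc v) (sc' v) => E [] E'; [left|right|right|left]; apply/funext => x;
    rewrite sE E E' ?mulrNN ?(mulr1, mul1r, mulN1r).
case=> ->; first by [].
by under [X in [set _; X]]eq_fun do rewrite opprK; rewrite setUC.
Qed.

(** Any two vertices lie inside a common good cycle far enough out, so the relative sign of the two
    states is the same at both. *)
Lemma ground_state_pair_unique (J : {fset V} -> R) (S S' : set (V -> R)) :
  connected_graph G -> choked G -> nondegenerate J ->
  ([set: V] !=set0 -> exists (v : V) N (C : nat -> seq V),
    [/\ forall n, chokes G N v (C n),
        forall n, surrounds G (C n.+1) (cycle_curve G (C n)) &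
        forall m, exists2 n, (m <= n)%N & good_cycle J N (C n)]) ->
  ground_state_pair G J S -> ground_state_pair G J S' -> S = S'.
Proof.
move=> cG chG nJ HC [s gs ->] [s' gs' ->].
have [sc _] := gs; have [sc' _] := gs'.
apply/esym/ground_state_opp => // x y.
have [|v [N [C [chC nC good]]]] := HC; first by exists x.
have [n Wx] := interior_exhausts chC nC x cG.
have [m Wy] := interior_exhausts chC nC y cG.
have [k mnk gk] := good (maxn m n).
have [t tP] := ground_states_agree_inside cG chG nJ (chC k) gk gs gs'.
rewrite geq_max in mnk; case/andP: mnk => mk nk.
rewrite !tP; last 2 first.
- exact: (interior_le chC nC mk).
- exact: (interior_le chC nC nk).
by rewrite -!mulrA !spin_sqr.
Qed.

(** Growing boxes each contain finitely many vertices. The sequence also serves as the countability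
    of [V]. *)
Lemma vertex_exhaustion : locally_finite G -> exists L : nat -> {fset V},
  forall D : {fset V}, \forall n \near \oo, (D `<=` L n)%fset.
Proof.
move=> lf; pose B (n : nat) : set (R * R) := `[- n%:R, n%:R] `*` `[- n%:R, n%:R].
have fB n : finite_set (pos G @^-1` B n).
  by apply: lf; apply: compact_setX; exact: segment_compact.
exists (fun n => fset_set (pos G @^-1` B n)) => D.
have bound x : \forall n \near \oo, x \in fset_set (pos G @^-1` B n).
  near=> n; rewrite in_fset_set // inE; split; rewrite /= in_itv /= -ler_norml.
    by near: n; exact: nbhs_infty_ger.
  by near: n; exact: nbhs_infty_ger.
have := @filter_bigI _ _ D (fun x n => x \in fset_set (pos G @^-1` B n)) \oo _.
move=> /(_ _ (fun x _ => bound x)); apply: filterS => n H.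
by apply/fsubsetP => x xD; exact: H.
Unshelve. all: by end_near.
Qed.

(** * Existence of ground states *)

Definition flip (D : {fset V}) s x := if x \in D then - s x else s x.

Lemma bond_flip_in (D : {fset V}) s e : edge_boundary G D e ->
  bond (flip D s) e = - bond s e.
Proof.
move=> [Ge [x [y [eE xD yD]]]].
have xy : x != y by apply: (@edge_neq _ _ G); rewrite -eE.
by rewrite eE !bond2 // /flip xD (negbTE yD) mulNr.
Qed.

Lemma bond_flip_out (D : {fset V}) s e : edges G e -> ~ edge_boundary G D e ->
  bond (flip D s) e = bond s e.
Proof.
move=> Ge De; have : (0 < #|` e|)%N by rewrite (edges_card2 Ge).
rewrite cardfs_gt0 => /fset0Pn[x xe]; have [y xy eE] := edge_other Ge xe.
rewrite eE !bond2 // /flip.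
have [xD|xD] := boolP (x \in D); have [yD|yD] := boolP (y \in D) => //.
- by rewrite mulrNN.
- by case: De; split=> //; exists x, y.
- by case: De; split=> //; exists y, x; split=> //; rewrite fsetUC.
Qed.

(** A maximiser of [H] among the configurations equal to 1 off [L] works: flipping [D] lowers [H] by
    twice the boundary sum over [D]. *)
Lemma finite_volume_ground_state (J : {fset V} -> R) (L : {fset V}) : choked G ->
  exists2 s, spin_config s & forall D : {fset V}, (D `<=` L)%fset ->
    0 <= \sum_(e <- fset_set (edge_boundary G D)) J e * bond s e.
Proof.
move=> chG.
pose T := [set e | edges G e /\ exists2 x, x \in L & x \in e].
have fT : finite_set T.
  apply: (@sub_finite_set _ _
    (\bigcup_(x in [set` L]) [set e | edges G e /\ x \in e])).
    by move=> e [Ge [x xL xe]]; exists x.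
  by apply: bigcup_finite => // x _; exact: finite_degree.
pose H s := \sum_(e <- fset_set T) J e * bond s e.
pose sg (A : {fset V}) : V -> R := flip A (fun=> 1).
have A0 : fset0 \in fpowerset L by rewrite fpowersetE fsub0set.
case: (@arg_maxP _ _ _ [` A0]%fset xpredT
  (fun A : fpowerset L => H (sg (val A)))) => //.
move=> A _ Amax; exists (sg (val A)) => [x|D DL].
  by rewrite /sg /flip; case: ifP; [right|left].
have AL : (val A `<=` L)%fset by rewrite -fpowersetE; exact: valP.
(* In terms of the set of minus spins, flipping [D] is a symmetric difference. *)
pose B := ((val A `\` D) `|` (D `\` val A))%fset.
have BL : B \in fpowerset L.
  by rewrite fpowersetE fsubUset !fsubDset !fsubsetU ?AL ?DL ?orbT.
have := Amax [` BL]%fset isT; rewrite /=.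
have -> : sg B = flip D (sg (val A)).
  apply/funext => x; rewrite /sg /flip !inE.
  by case: (x \in D) (x \in val A) => -[]; rewrite /= ?opprK.
have fD : finite_set (edge_boundary G D) by exact: finite_edge_boundary.
have DT : (fset_set (edge_boundary G D) `<=` fset_set T)%fset.
  apply/fsubsetP => e; rewrite !in_fset_set // !inE => -[Ge [x [y [eE xD yD]]]].
  split=> //.
  by exists x; [exact: (fsubsetP DL)|rewrite eE !inE eqxx].
rewrite /H -subr_ge0 -sumrB.
rewrite (_ : \sum_(e <- fset_set T) _ =
    2%:R * \sum_(e <- fset_set (edge_boundary G D)) J e * bond (sg (val A)) e).
  by rewrite pmulr_rge0 ?ltr0n.
rewrite mulr_sumr -(big_fset_incl _ DT) => [|e eT eD].
  apply: eq_big_seq => e; rewrite in_fset_set // inE => De.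
  by rewrite bond_flip_in // mulrN opprK mulr_natl mulr2n.
rewrite bond_flip_out ?subrr //.
  by move: eT; rewrite in_fset_set // inE => -[].
by move=> De; case/negP: eD; rewrite in_fset_set // inE.
Qed.

Lemma ground_state_exists (J : {fset V} -> R) : choked G ->
  exists s, ground_state G J s.
Proof.
move=> chG; have [lf _] := chG; have [L LP] := vertex_exhaustion lf.
have /choice[s sP] : forall n, exists s, spin_config s /\
    forall D : {fset V}, (D `<=` L n)%fset ->
    0 <= \sum_(e <- fset_set (edge_boundary G D)) J e * bond s e.
  by move=> n; have [s] := finite_volume_ground_state J (L n) chG; exists s.
have [U [uU ooU]] := @ultraFilterLemma _ \oo _.
(* [l x] is the value of [s n x] for [U]-most [n]; the branch -1 is right because an ultrafilter
   contains each set or its complement. *)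
pose l x : R := if pselect (U [set n | s n x = 1]) is left _ then 1 else -1.
have lP x : U [set n | s n x = l x].
  rewrite /l; case: pselect => // nU.
  have [//|] := in_ultra_setVsetC [set n | s n x = 1] uU.
  by apply: filterS => n /= sn; have [sc _] := sP n; case: (sc x).
exists l; apply/ground_stateP => //; split => [x|D].
  by rewrite /l; case: pselect => _; [left|right].
pose F := fset_set (edge_boundary G D).
pose S := (\bigcup_(e <- F) e)%fset.
have US : U (\bigcap_(x in [set` S]) [set n | s n x = l x]).
  by apply: filter_bigI => x _; exact: lP.
(* Finitely many spins enter the boundary sum, so a single [n] has [D] within its volume and agrees
   with [l] on all of them. *)
have [n [Dn Sn]] := filter_ex (filterI (ooU _ (LP D)) US).
have [_ /(_ D Dn)] := sP n; congr (0 <= _); apply: eq_big_seq => e eF.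
congr (_ * _); apply: eq_big_seq => x xe; apply: Sn => /=.
by apply/bigfcupP; exists e; rewrite ?eF.
Qed.

End GroundStates.

(** * Independent couplings *)

Lemma measurable_lincomb d (T : measurableType d) (R : realType) (I : choiceType)
    (F : {fset I}) (eps : I -> R) (Y : I -> T -> R) :
  (forall i, i \in F -> measurable_fun setT (Y i)) ->
  measurable_fun setT (fun w => \sum_(i <- F) eps i * Y i w).
Proof.
move=> mY; under eq_fun do rewrite big_seq big_mkcond /=.
apply: measurable_sum => i; case: (boolP (i \in F)) => // iF.
by apply: measurable_funM => //; exact: mY.
Qed.

(** An atom would be a jump of the distribution function: its values at all [y < x] stay below the
    value at [x] by at least the mass of [x]. *)
Lemma continuous_law_set1 (R : realType) (mu : probability R R) (x : R) :
  continuous_law mu -> mu [set x] = 0%E.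
Proof.
move=> cmu; apply/eqP; rewrite eq_le measure_ge0 andbT.
have Fx : mu `]-oo, x]%classic \is a fin_num by exact: fin_num_measure.
suff : (mu `]-oo, x]%classic <= mu `]-oo, x]%classic - mu [set x])%E.
  rewrite -{1}(adde0 (mu _)) leeBrDr ?fin_num_measure // adde0.
  by rewrite -[leRHS]adde0 leeD2lE.
apply: (@cvge_le _ (x^'-) _ _ (fun y => mu `]-oo, y]%classic)); last first.
  exact: (cvg_at_left_filter (cmu x)).
near=> y; rewrite leeBrDr ?fin_num_measure //.
have yx : y < x by near: y; exact: nbhs_left_lt.
rewrite -measureU //; last first.
  apply/seteqP; split=> z //= -[]; rewrite in_itv /= => + zx; rewrite zx.
  by rewrite leNgt yx.
apply: le_measure; rewrite ?inE //; first exact: measurableU.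
move=> z /= []; rewrite !in_itv /=; last by move=> ->.
by move=> /le_trans; apply; exact: ltW.
Unshelve. all: by end_near.
Qed.

Section IndependentFamily.
Context (d : measure_display) (T : measurableType d) (R : realType).
Context (P : probability T R) (I : choiceType) (E : set I).
Context (X : I -> {RV P >-> R}) (mu : probability R R).
Hypothesis iidX : iid_on E X mu.
Implicit Types (F : {fset I}) (A : I -> set R).

Definition rectangle F A : set T := \bigcap_(i in [set` F]) (X i @^-1` A i).

Definition rectangle_mass F A : R := \prod_(i <- F) fine (mu (A i)).

Lemma measurable_rectangle F A : (forall i, measurable (A i)) ->
  measurable (rectangle F A).
Proof.
move=> mA; apply: fin_bigcap_measurable => [|i _]; first exact: finite_fset.
exact: measurable_funPTI.
Qed.

Lemma rectangleE F A : [set` F] `<=` E -> (forall i, measurable (A i)) ->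
  P (rectangle F A) = (rectangle_mass F A)%:E.
Proof.
move=> FE mA; have [indep law] := iidX.
rewrite /rectangle indep // -prodEFin; apply: eq_big_seq => i iF.
by rewrite fineK ?fin_num_measure // -(law _ (FE _ iF) _ (mA i)).
Qed.

Lemma rectangleI F F' A A' : [disjoint F & F']%fset ->
  rectangle F A `&` rectangle F' A' =
  rectangle (F `|` F')%fset (fun i => if i \in F then A i else A' i).
Proof.
move=> /fdisjointP FF'; apply/seteqP; split=> [w [wF wF'] i /=|w wFF'].
  rewrite inE => /orP[] iF; first by rewrite iF; exact: wF.
  case: ifPn => iF'; last exact: wF'.
  by move: (FF' _ iF'); rewrite iF.
split=> i /= iF; have := wFF' i; rewrite /= inE iF ?orbT; first exact.
by case: ifPn => iF'; [move: (FF' _ iF'); rewrite iF|exact].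
Qed.

Lemma rectangle_massU F F' A A' : [disjoint F & F']%fset ->
  rectangle_mass (F `|` F')%fset (fun i => if i \in F then A i else A' i) =
  rectangle_mass F A * rectangle_mass F' A'.
Proof.
move=> FF'; rewrite /rectangle_mass.
rewrite (perm_big (F ++ F')) /=.
  rewrite big_cat /=; congr (_ * _); apply: eq_big_seq => i iF.
    by rewrite iF.
  case: ifPn => // iF'; by move/fdisjointP: FF' => /(_ _ iF'); rewrite iF.
apply: uniq_perm; rewrite ?fset_uniq //.
  rewrite cat_uniq !fset_uniq andbT /=; apply/hasPn => i iF'.
  by apply/negP => iF; move/fdisjointP: FF' => /(_ _ iF); rewrite iF'.
by move=> i; rewrite inE mem_cat.
Qed.

(** The extra rectangle over [F] carries the induction: avoiding one more event subtracts the part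
    where it occurs, and by disjointness this event and the rectangle intersect in a rectangle
    again. *)
Lemma independent_events_avoid (F_ : nat -> {fset I}) (A_ : nat -> I -> set R) m F A :
  (forall k, [set` F_ k] `<=` E) -> (forall k i, measurable (A_ k i)) ->
  (forall j k, (j < k)%N -> [disjoint F_ j & F_ k]%fset) ->
  [set` F] `<=` E -> (forall i, measurable (A i)) ->
  (forall k, (k < m)%N -> [disjoint F_ k & F]%fset) ->
  let avoid := [set w | forall k, (k < m)%N -> ~ rectangle (F_ k) (A_ k) w] in
  measurable avoid /\
  P (avoid `&` rectangle F A) =
  ((\prod_(k < m) (1 - rectangle_mass (F_ k) (A_ k))) * rectangle_mass F A)%:E.
Proof.
move=> FE mA_ dF; elim: m F A => [|m IH] F A FE' mA dFF /=.
  rewrite (_ : [set w | _] = setT); last by apply/seteqP; split.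
  by split=> //; rewrite setTI big_ord0 mul1r rectangleE.
set N1 := [set w | _].
pose N0 := [set w | forall k, (k < m)%N -> ~ rectangle (F_ k) (A_ k) w].
have N1E : N1 = N0 `\` rectangle (F_ m) (A_ m).
  apply/seteqP; split=> w.
    by move=> Nw; split=> [k km|]; apply: Nw => //; exact: ltnW.
  by move=> [Nw mw] k; rewrite ltnS leq_eqVlt => /predU1P[->//|]; exact: Nw.
have [mN0 PN0] := IH F A FE' mA (fun k km => dFF k (ltnW km)).
have mR := measurable_rectangle (F_ m) (mA_ m).
have mRF := measurable_rectangle F mA.
split; first by rewrite N1E; exact: measurableD.
rewrite -/N0 in mN0 PN0.
have -> : P (N1 `&` rectangle F A) = (P (N0 `&` rectangle F A) -
    P (N0 `&` (rectangle (F_ m) (A_ m) `&` rectangle F A)))%E.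
  rewrite N1E setDE setIAC -setDE measureD //; last 2 first.
  - exact: measurableI.
  - by apply: (le_lt_trans (probability_le1 _ _)); [exact: measurableI|rewrite ltry].
  by rewrite -setIA [rectangle F A `&` _]setIC.
rewrite PN0 rectangleI; last exact: dFF.
have [||k km|_ ->] := IH (F_ m `|` F)%fset
  (fun i => if i \in F_ m then A_ m i else A i).
- by move=> i /=; rewrite inE => /orP[] iF; [exact: (FE m)|exact: FE'].
- by move=> i; case: ifP.
- by rewrite fdisjointXU dF // dFF // ltnW.
rewrite rectangle_massU; last exact: dFF.
rewrite -EFinB big_ord_recr /=; congr EFin; ring.
Qed.

(* The second Borel-Cantelli lemma for events depending on disjoint sets of
   coordinates. *)
Lemma ae_exists_rectangle (F_ : nat -> {fset I}) (A_ : nat -> I -> set R) (c : R) :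
  (forall k, [set` F_ k] `<=` E) -> (forall k i, measurable (A_ k i)) ->
  (forall j k, (j < k)%N -> [disjoint F_ j & F_ k]%fset) ->
  0 < c -> (forall k, c <= rectangle_mass (F_ k) (A_ k)) ->
  {ae P, forall w, exists k, rectangle (F_ k) (A_ k) w}.
Proof.
move=> FE mA dF c0 cF.
have le1 k : rectangle_mass (F_ k) (A_ k) <= 1.
  rewrite -lee_fin -rectangleE //; apply: probability_le1.
  exact: measurable_rectangle.
have c1 : c <= 1 by exact: le_trans (cF 0%N) (le1 0%N).
(* [N m] is the failure of the first [m] events; its probability decays geometrically. *)
pose N m := [set w | forall k, (k < m)%N -> ~ rectangle (F_ k) (A_ k) w].
have PN m : measurable (N m) /\ (P (N m) <= ((1 - c) ^+ m)%:E)%E.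
  have E0 : [set` (fset0 : {fset I})] `<=` E by move=> i; rewrite /= inE.
  have [mN] := independent_events_avoid FE mA dF E0 (fun=> measurableT)
    (fun k (_ : (k < m)%N) => fdisjointX0 (F_ k)).
  rewrite -/(N m) (_ : rectangle fset0 _ = setT); last first.
    by apply/seteqP; split=> // w _ i; rewrite /= inE.
  rewrite setIT => ->; split=> //; rewrite lee_fin /rectangle_mass big_seq_fset0 mulr1.
  rewrite -[X in _ ^+ X]card_ord -prodr_const; apply: ler_prod => i _.
  by rewrite subr_ge0 le1 lerD2l lerN2 cF.
pose B := \bigcap_m N m.
have mB : measurable B by apply: bigcap_measurable => // m _; case: (PN m).
exists B; split=> //; last first.
  move=> w /= nw m _ k km kw; apply: nw; by exists k.
apply/eqP; rewrite eq_le measure_ge0 andbT.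
have cv : ((1 - c) ^+ m)%:E @[m --> \oo] --> 0%:E.
  apply: cvg_EFin; first by near=> m.
  apply: cvg_expr; rewrite ger0_norm ?subr_ge0 // ltrBlDr ltrDl //.
apply: (cvge_to_ge cv); near=> m.
apply: le_trans (PN m).2; apply: le_measure; rewrite ?inE //; first by case: (PN m).
exact: bigcap_inf.
Unshelve. all: by end_near.
Qed.

(** Both sides are finite measures in [B] that agree on the rectangles over [F], a class stable
    under intersection, hence on the sigma-algebra it generates. *)
Lemma independent_sigma_algebra F i0 (A : set R) (B : set T) :
  i0 \notin F -> E i0 -> [set` F] `<=` E -> measurable A ->
  <<s [set rectangle F A' | A' in [set A' | forall i, measurable (A' i)]] >> B ->
  P (B `&` X i0 @^-1` A) = (P B * mu A)%E.
Proof.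
move=> i0F Ei0 FE mA; set G := (X in <<s X >>) => GB.
have mX0 : measurable (X i0 @^-1` A) by exact: measurable_funPTI.
have Gm : G `<=` measurable by move=> _ [A' mA' <-]; exact: measurable_rectangle.
have GT : G setT.
  exists (fun=> setT) => //; by apply/seteqP; split.
have GI : setI_closed G.
  move=> _ _ [A1 mA1 <-] [A2 mA2 <-]; exists (fun i => A1 i `&` A2 i).
    by move=> i /=; apply: measurableI; [exact: mA1|exact: mA2].
  apply/seteqP; split=> w; first by move=> H; split=> i iF; case: (H i iF).
  by move=> [H1 H2] i iF; split; [exact: H1|exact: H2].
have a0 : 0 <= fine (mu A) by exact: fine_ge0.
have PBE C : (mscale (NngNum a0) P) C = (P C * mu A)%E.
  by rewrite /mscale /= fineK ?fin_num_measure // muleC.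
rewrite -PBE -[LHS]/(mrestr P mX0 B).
apply: (g_sigma_algebra_measure_unique G Gm (fun=> setT)) => //.
- by apply/seteqP; split=> // w _; exists 0%N.
- move=> _ [A' mA' <-]; apply: etrans (esym (PBE _)).
  rewrite -[LHS]/(P (rectangle F A' `&` X i0 @^-1` A)).
  have -> : X i0 @^-1` A = rectangle [fset i0]%fset (fun=> A).
    apply/seteqP; split=> w; first by move=> H i /=; rewrite inE => /eqP->.
    by move=> /(_ i0) H; apply: H; rewrite /= inE.
  have dj : [disjoint F & [fset i0]]%fset by rewrite fdisjointX1.
  rewrite rectangleI // rectangleE; last 2 first.
  - by move=> i /=; rewrite !inE => /orP[/FE//|/eqP->].
  - by move=> i; case: ifP.
  rewrite rectangle_massU // rectangleE // -[mu A]fineK ?fin_num_measure // -EFinM.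
  by congr (_ * _)%:E; rewrite /rectangle_mass big_seq_fset1.
- by move=> _; apply: (le_lt_trans (probability_le1 _ _)); [exact: measurableI|rewrite ltry].
Qed.

(* The law of the sum of the other terms and the last term is a product, and
   the diagonal is null for it since one factor has no atoms. *)
Lemma lincomb_neq0 F (eps : I -> R) : continuous_law mu -> [set` F] `<=` E ->
  F != fset0 -> (forall i, eps i != 0) ->
  {ae P, forall w, \sum_(i <- F) eps i * X i w != 0}.
Proof.
move=> cmu FE /fset0Pn[i0 i0F] eps0.
pose F' := (F `\ i0)%fset.
have F'E : [set` F'] `<=` E by move=> i /=; rewrite !inE => /andP[_ /FE].
have i0F' : i0 \notin F' by rewrite !inE eqxx.
(* [Z] is the value that [X i0] must take for the sum to vanish. *)
pose Z w := \sum_(i <- F') (- (eps i0)^-1 * eps i) * X i w.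
have mZ : measurable_fun setT Z.
  by apply: measurable_lincomb => i _; exact: measurable_funPT.
pose G := [set rectangle F' A' | A' in [set A' | forall i, measurable (A' i)]].
have GZ (A : set R) : measurable A -> <<s G >> (Z @^-1` A).
  move=> mA; rewrite -[_ @^-1` _]setTI.
  have : measurable_fun setT (Z : g_sigma_algebraType G -> R).
    apply: (@measurable_lincomb _ (g_sigma_algebraType G)) => i iF'.
    move=> _ Y mY; rewrite setTI; apply: sub_sigma_algebra.
    exists (fun j => if j == i then Y else setT) => [j /=|]; first by case: ifP.
    apply/seteqP; split=> w; first by move=> /(_ i iF') /=; rewrite eqxx.
    by move=> Yw j _ /=; case: eqP => // ->.
  by apply.
pose Zm : {RV P >-> R} := HB.pack Z (isMeasurableFun.Build _ _ _ _ Z mZ).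
have mW : measurable_fun setT (fun w => (Z w, X i0 w)).
  by apply: measurable_fun_pair => //; exact: measurable_funPT.
pose Wm : {RV P >-> (R * R)%type} := HB.pack (fun w => (Z w, X i0 w))
  (isMeasurableFun.Build _ _ _ _ (fun w => (Z w, X i0 w)) mW).
pose D := [set p : R * R | p.1 - p.2 = 0].
have mD : measurable D.
  have -> : D = (fun p : R * R => p.1 - p.2) @^-1` [set 0] by [].
  rewrite -[_ @^-1` _]setTI; apply: measurable_funB => //.
have := @product_measure_unique _ _ _ _ _ (distribution P Zm) mu
  (distribution P Wm) _ D mD.
rewrite /product_measure1 integral0_eq; last first.
  move=> z _ /=; rewrite (_ : xsection D z = [set z]) ?continuous_law_set1 //.
  apply/seteqP; split=> y; rewrite /xsection /= inE /D /=.
    by move=> /eqP; rewrite subr_eq0 => /eqP.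
  by move=> ->; rewrite subrr.
move=> H; exists (Wm @^-1` D); split.
- exact: measurable_funPTI.
- rewrite /= -[LHS]H // => A B mA mB /=.
  have := independent_sigma_algebra i0F' _ F'E mB (GZ _ mA).
  by move=> <- //; exact: FE.
- move=> w /= /negP; rewrite negbK => /eqP; rewrite (big_fsetD1 i0) //= => S0.
  have SE : \sum_(i <- F') eps i * X i w = - (eps i0 * X i0 w).
    by apply/eqP; rewrite -addr_eq0 addrC S0.
  rewrite /D /= /Z; under eq_bigr do rewrite -mulrA.
  by rewrite -mulr_sumr SE mulrNN mulKf // subrr.
Qed.

End IndependentFamily.

(** * Almost sure properties of the couplings *)

Section RandomCouplings.
Context (R : realType) (V : choiceType) (G : plane_graph R V).
Context (d : measure_display) (T : measurableType d) (P : probability T R).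
Context (mu : probability R R) (J : {fset V} -> {RV P >-> R}).
Hypothesis iidJ : iid_on (edges G) J mu.

(** Each signed sum is almost surely nonzero, and edge sets within the finite sets [L n] give
    countably many cases. *)
Lemma ae_nondegenerate : locally_finite G -> continuous_law mu ->
  {ae P, forall w, nondegenerate G (fun e => J e w)}.
Proof.
move=> lf cmu; have [L LP] := vertex_exhaustion lf.
pose ok (F S : {fset {fset V}}) := [set w | F != fset0 ->
  (forall e, e \in F -> edges G e) ->
  \sum_(e <- F) (if e \in S then J e w else - J e w) != 0].
have okP F S : {ae P, forall w, ok F S w}.
  have [F0|F0] := boolP (F != fset0); last first.
    by apply: aeW => w; rewrite /ok /= (negbTE F0).
  have [FE|FE] := pselect (forall e, e \in F -> edges G e); last first.
    by apply: aeW => w _ /FE.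
  have := lincomb_neq0 (eps := fun e => if e \in S then 1 else -1) iidJ cmu FE F0.
  have eps0 e : (if e \in S then 1 else -1 : R) != 0.
    by case: ifP; rewrite ?oppr_eq0 oner_eq0.
  move=> /(_ eps0); apply: filterS => w + _ _.
  congr (_ != 0); apply: eq_bigr => e _.
  by case: ifP; rewrite ?mul1r ?mulN1r.
have : {ae P, forall w, forall n,
    (\bigcap_(F in [set` fpowerset (fpowerset (L n))])
      \bigcap_(S in [set` fpowerset (fpowerset (L n))]) ok F S) w}.
  apply: ae_foralln => n; apply: filter_bigI => F _; apply: filter_bigI => S _.
  exact: okP.
apply: filterS => w okw F S F0 FE.
have [n Fn] := filter_ex (LP (\bigcup_(e <- F) e)%fset).
have FL : F \in fpowerset (fpowerset (L n)).
  rewrite fpowersetE; apply/fsubsetP => e eF; rewrite fpowersetE.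
  apply: fsubset_trans Fn; apply/fsubsetP => x xe.
  by apply/bigfcupP; exists e; rewrite ?eF.
(* Only the trace of [S] on [F] affects the sum, so for each [n] finitely many sign choices
   suffice. *)
have SL : (S `&` F)%fset \in fpowerset (fpowerset (L n)).
  by move: FL; rewrite !fpowersetE; apply: fsubset_trans; exact: fsubsetIr.
have := okw n F FL _ SL F0 FE; congr (_ != 0).
by apply: eq_big_seq => e eF; rewrite inE eF andbT.
Qed.

Lemma law_support_gt0 (U : set R) x : law_support mu = setT -> open U -> U x ->
  0 < fine (mu U).
Proof.
move=> /seteqP[_ /(_ x I) H] oU Ux; apply: fine_gt0; rewrite H //=.
by rewrite ltey_eq fin_num_measure //; exact: open_measurable.
Qed.

Lemma ae_good_cycles v N (C : nat -> seq V) : law_support mu = setT ->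
  (forall n, chokes G N v (C n)) ->
  (forall n, surrounds G (C n.+1) (cycle_curve G (C n))) ->
  {ae P, forall w, forall m,
    exists2 n, (m <= n)%N & good_cycle G (fun e => J e w) N (C n)}.
Proof.
move=> supp chC nC; apply: ae_foralln => m.
(* Even indices keep the cycles two apart, so their touched edges are disjoint; the shift by [m]
   puts their indices at or beyond [m]. *)
pose c k := C (m + k).*2.
pose F k := fset_set (touched_edges G (c k)).
have fT k : finite_set (touched_edges G (c k)) by case: (chC (m + k).*2).
have cyc k : is_cycle G (c k) by case: (chC (m + k).*2).
have N0 : (0 < N%:R^-1 :> R).
  rewrite invr_gt0 ltr0n; have [_ _ _] := chC 0%N; exact: leq_ltn_trans.
pose A k e : set R := if `[< cycle_edges (c k) e >] then `]1, +oo[%classic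
  else `](- N%:R^-1), N%:R^-1[%classic.
have mA k e : measurable (A k e) by rewrite /A; case: ifP.
(* [a] is a lower bound, positive by full support, for the probability that one edge meets its
   constraint. *)
pose a := Num.min (fine (mu `]1, +oo[%classic))
  (fine (mu `](- N%:R^-1), N%:R^-1[%classic)).
have a0 : 0 < a.
  rewrite lt_min; apply/andP; split.
    apply: (@law_support_gt0 _ 2) => //.
    by rewrite /= in_itv /= andbT ltr1n.
  apply: (@law_support_gt0 _ 0) => //.
  by rewrite /= in_itv /= oppr_lt0 N0.
have a1 : a <= 1.
  rewrite ge_min; apply/orP; left.
  by rewrite -lee_fin fineK ?fin_num_measure //; exact: probability_le1.
have aA k e : a <= fine (mu (A k e)).
  by rewrite /A; case: ifP => _; rewrite ge_min lexx ?orbT.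
have FE k : [set` F k] `<=` edges G.
  by move=> e; rewrite /= in_fset_set // inE => -[].
have dF j k : (j < k)%N -> [disjoint F j & F k]%fset.
  move=> jk; apply/fdisjointP => e; rewrite !in_fset_set // !inE => ej.
  apply/negP; rewrite inE; apply: (touched_edges_disjoint chC nC _ ej).
  by rewrite -doubleS leq_double ltn_add2l.
(* Fewer than [N] edges are touched and [a <= 1], so the bound is uniform in [k]. *)
have massF k : a ^+ N <= rectangle_mass mu (F k) (A k).
  apply: (@le_trans _ _ (a ^+ #|` F k|)).
    apply: ler_wiXn2l => //; first exact: ltW.
    by apply: ltnW; case: (chC (m + k).*2).
  rewrite /rectangle_mass -[X in _ ^+ X]count_predT -iter_mulr_1 -big_const_seq.
  by apply: ler_prod => e _; rewrite ltW //= aA.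
have := ae_exists_rectangle iidJ FE mA dF (exprn_gt0 N a0) massF.
apply: filterS => w [k kw]; exists (m + k).*2.
  by rewrite -addnn -addnA leq_addr.
split=> e.
  move=> ce; have eF : e \in F k.
    rewrite in_fset_set // inE; split; last by left.
    by case: ce => x /= xc <-; exact: (cycle_edge (cyc k)).
  have := kw e eF; rewrite /= /A; case: asboolP => // _.
  by rewrite /= in_itv /= andbT.
move=> te nce; have eF : e \in F k by rewrite in_fset_set // inE.
have := kw e eF; rewrite /= /A; case: asboolP => // _.
by rewrite /= in_itv /= -ltr_norml.
Qed.

End RandomCouplings.

Theorem theorem31 (R : realType) (V : choiceType) (G : plane_graph R V)
    (d : measure_display) (T : measurableType d) (P : probability T R)
    (mu : probability R R) (J : {fset V} -> {RV P >-> R}) :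
  connected_graph G ->
  choked G ->
  symmetric_law mu ->
  continuous_law mu ->
  law_support mu = setT ->
  iid_on (edges G) J mu ->
  {ae P, forall w, exists! S : set (V -> R),
    ground_state_pair G (fun e => J e w) S}.
Proof.
move=> cG chG _ cmu supp iidJ.
have good : {ae P, forall w, [set: V] !=set0 -> exists (v : V) N (C : nat -> seq V),
    [/\ forall n, chokes G N v (C n),
        forall n, surrounds G (C n.+1) (cycle_curve G (C n)) &
        forall m, exists2 n, (m <= n)%N & good_cycle G (fun e => J e w) N (C n)]}.
  have [[v _]|V0] := pselect ([set: V] !=set0); last by apply: aeW.
  have [_ /(_ v)[N [_ [C [chC nC]]]]] := chG.
  by have := ae_good_cycles iidJ supp chC nC; apply: filterS => w; exists v, N, C.
apply: filterS2 (ae_nondegenerate iidJ chG.1 cmu) good => w nJ good.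
(* Existence holds for every choice of couplings; the almost sure events serve uniqueness. *)
have [s gs] := ground_state_exists (fun e => J e w) chG.
exists [set s; (fun x => - s x)]; split; first by exists s.
by move=> S' gS'; apply: (ground_state_pair_unique cG chG nJ good) gS'; exists s.
Qed.
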